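(* Let $(A,\rho,[\cdot,\cdot])$ be an almost Lie algebroid over a smooth manifold $M$, with Jacobiator $J(\phi,\psi,\chi)=[\phi,[\psi,\chi]]+[\psi,[\chi,\phi]]+[\chi,[\phi,\psi]]$ for $\phi,\psi,\chi\in\Gamma(A)$. Then $\rho\circ J=0$, $J\in\Omega^3_M(A,\ker\rho)$ and $DJ=0$. (In other words, every almost Lie algebroid is an H-twisted Lie algebroid.)
   Context: An almost Lie algebroid $(A,\rho,[\cdot,\cdot])$ over a smooth manifold $M$ is a (real, finite rank, smooth) vector bundle $A\to M$ together with an $\mathbb{R}$-bilinear skew-symmetric bracket $[\cdot,\cdot]$ on $\Gamma(A)$ and a vector bundle morphism $\rho\colon A\to TM$ (the anchor) such that for all $\phi,\psi\in\Gamma(A)$, $f\in C^\infty(M)$: $[\phi,f\psi]=\rho(\phi)[f]\,\psi+f[\phi,\psi]$ and $\rho([\phi,\psi])=[\rho(\phi),\rho(\psi)]$. The Jacobi identity is not assumed, and $\rho$ need not have constant rank. $\Gamma(\ker\rho)$ denotes $\{v\in\Gamma(A):\rho(v)=0\}$, and $\Omega^p_M(A,\ker\rho)$ denotes the set of $\omega\in\Gamma(\wedge^pA^*\otimes A)$ with $\rho\circ\omega=0$; that is, $C^\infty(M)$-multilinear alternating maps $\omega\colon\Gamma(A)^p\to\Gamma(A)$ with values in $\Gamma(\ker\rho)$. For $\phi\in\Gamma(A)$ and $v\in\Gamma(\ker\rho)$ put $\nabla_\phi v:=[\phi,v]\in\Gamma(\ker\rho)$. The exterior covariant derivative $D$ sends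 $\alpha\in\Omega^p_M(A,\ker\rho)$ to $D\alpha\in\Omega_M^{p+1}(A,\ker\rho)$ given by $$D\alpha(\psi_0,\dots,\psi_p)=\sum_{i=0}^p(-1)^i\nabla_{\psi_i}\big(\alpha(\psi_0,\dots,\hat\psi_i,\dots,\psi_p)\big)+\sum_{i<j}(-1)^{i+j}\alpha([\psi_i,\psi_j],\psi_0,\dots,\hat\psi_i,\dots,\hat\psi_j,\dots,\psi_p).$$ An H-twisted Lie algebroid is an almost Lie algebroid whose Jacobiator satisfies $DJ=0$. *)

(* Defs.v *)
From HB Require Import structures.
From mathcomp Require Import all_boot all_order all_algebra.
From mathcomp Require Import ring.
From mathcomp Require Import boolp classical_sets functions cardinality reals.
From mathcomp Require Import topology normedtype derive.

Set Implicit Arguments.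
Unset Strict Implicit.
Unset Printing Implicit Defensive.
Import Order.TTheory GRing.Theory Num.Theory.
Import numFieldNormedType.Exports.

Local Open Scope classical_set_scope.
Local Open Scope ring_scope.

Lemma near_eq_continuous (S T : topologicalType) (f g : S -> T) (x : S) :
  (\forall y \near x, f y = g y) -> {for x, continuous f} ->
  {for x, continuous g}.
Proof.
move=> fg; rewrite /prop_for /continuous_at (nbhs_singleton fg).
by apply: cvg_trans; exact: near_eq_cvg.
Qed.

Section Euclidean.
Context {R : realType} {n : nat}.
Implicit Types (U V : set 'rV[R]_n) (f g : 'rV[R]_n -> R).

(* [f] is C^k on the open set [U]: all iterated partial derivatives of order
   at most [k] exist and are continuous at the points of [U].  Values of [f]
   outside [U] are irrelevant ([Ck_eq]). *)
Fixpoint Ck (k : nat) U f : Prop :=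
  (forall u, U u -> {for u, continuous f}) /\
  if k is k'.+1 then
    forall i : 'I_n, (forall u, U u -> derivable f u (delta_mx 0 i)) /\
                     Ck k' U ('D_(delta_mx 0 i) f)
  else True.

Definition Cinfty U f := forall k, Ck k U f.

Lemma Ck_cont k U f : Ck k U f -> forall u, U u -> {for u, continuous f}.
Proof. by case: k => [|k] []. Qed.

Lemma Ck_pred k U f : Ck k.+1 U f -> Ck k U f.
Proof.
elim: k f => [|k IH] f [cf df]; split=> // i.
by have [dif ckf] := df i; split=> //; exact: IH.
Qed.

Lemma Ck_local k U f :
  (forall u, U u -> exists2 V, V u & Ck k V f) -> Ck k U f.
Proof.
elim: k f => [|k IH] f UV; (split;
  first by move=> u /UV[V Vu /Ck_cont]; apply) => // i; split.
  by move=> u /UV[V Vu [_ /(_ i)[+ _]]]; apply.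
by apply: IH => u /UV[V Vu [_ /(_ i)[_ ?]]]; exists V.
Qed.

Lemma Ck_sub k U V f : V `<=` U -> Ck k U f -> Ck k V f.
Proof. by move=> VU cU; apply: Ck_local => u /VU; exists U. Qed.

Lemma Ck_eq k U f g : open U -> (forall u, U u -> f u = g u) ->
  Ck k U f -> Ck k U g.
Proof.
move=> oU.
have nfg (h h' : 'rV[R]_n -> R) u : (forall v, U v -> h v = h' v) -> U u ->
    \forall v \near u, h v = h' v.
  move=> hh' Uu; have : nbhs u U by exact: open_nbhs_nbhs.
  by apply: filterS => v; exact: hh'.
elim: k f g => [|k IH] f g fg ckf.
  split=> // u Uu.
  by apply: near_eq_continuous (Ck_cont ckf Uu); exact: nfg.
case: (ckf) => _ df; split=> [u Uu|i].
  by apply: near_eq_continuous (Ck_cont ckf Uu); exact: nfg.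
have [dif ckf'] := df i; split=> [u Uu|].
  exact: near_eq_derivable (nfg f g u fg Uu) (dif u Uu).
by apply: (IH _ _ _ ckf') => u Uu; apply: near_eq_derive; exact: nfg.
Qed.

Lemma Ck_cst k U (a : R) : Ck k U (fun=> a).
Proof.
elim: k a => [|k IH] a; (split; first by move=> u _; exact: cst_continuous) => //.
move=> i; split=> [u _|]; first exact: derivable_cst.
rewrite (_ : 'D__ _ = fun=> 0); first exact: IH.
by apply/funext => u; rewrite -[LHS]/('D__ (cst a) u) derive_cst.
Qed.

Lemma CkD k U f g : open U -> Ck k U f -> Ck k U g ->
  Ck k U (fun u => f u + g u).
Proof.
move=> oU; elim: k f g => [|k IH] f g ckf ckg; (split;
  first by move=> u Uu; exact: cvgD (Ck_cont ckf Uu) (Ck_cont ckg Uu)) => // i.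
have [[_ /(_ i)[df ddf]] [_ /(_ i)[dg ddg]]] := (ckf, ckg).
split=> [u Uu|]; first exact: derivableD (df u Uu) (dg u Uu).
apply: Ck_eq (IH _ _ ddf ddg) => // u Uu.
exact: esym (deriveD (df u Uu) (dg u Uu)).
Qed.

Lemma CkM k U f g : open U -> Ck k U f -> Ck k U g ->
  Ck k U (fun u => f u * g u).
Proof.
move=> oU; elim: k f g => [|k IH] f g ckf ckg; (split;
  first by move=> u Uu; exact: cvgM (Ck_cont ckf Uu) (Ck_cont ckg Uu)) => // i.
have [[_ /(_ i)[df ddf]] [_ /(_ i)[dg ddg]]] := (ckf, ckg).
split=> [u Uu|]; first exact: derivableM (df u Uu) (dg u Uu).
apply: Ck_eq (CkD oU (IH _ _ (Ck_pred ckf) ddg) (IH _ _ (Ck_pred ckg) ddf)) => //.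
by move=> u Uu; exact: esym (deriveM (df u Uu) (dg u Uu)).
Qed.

End Euclidean.

(* The inverse of a chart is a total function; only its values on the image
   of the domain matter. *)
Record chart (R : realType) (n : nat) (M : topologicalType) := Chart {
  chart_dom : set M;
  chart_map :> M -> 'rV[R]_n;
  chart_inv : 'rV[R]_n -> M;
  chart_dom_open : open chart_dom;
  chart_img_open : open (chart_map @` chart_dom);
  chart_mapK : forall x, chart_dom x -> chart_inv (chart_map x) = x;
  chart_map_cont : forall x, chart_dom x -> {for x, continuous chart_map};
  chart_inv_cont : forall u, (chart_map @` chart_dom) u ->
    {for u, continuous chart_inv} }.

(* The atlas need not be maximal. *)
Record manifold (R : realType) (n : nat) := Manifold {
  mcarrier :> topologicalType;
  mhausdorff : hausdorff_space mcarrier;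
  msecond_countable : @second_countable mcarrier;
  atlas : set (chart R n mcarrier);
  atlas_cover : forall x, exists2 c, atlas c & chart_dom c x;
  atlas_compat : forall c d, atlas c -> atlas d -> forall i : 'I_n,
    Cinfty (c @` (chart_dom c `&` chart_dom d))
           (fun u => d (chart_inv c u) 0 i) }.

Section Functions.
Context {R : realType} {n : nat} (M : manifold R n).
Implicit Types (U V : set M) (f g : M -> R).

Definition smooth_on U f := forall c, atlas c ->
  Cinfty (c @` (chart_dom c `&` U)) (f \o chart_inv c).

Lemma chart_setI_open (c : chart R n M) U : open U ->
  open (c @` (chart_dom c `&` U)).
Proof.
move=> oU.
have -> : c @` (chart_dom c `&` U) =
    (c @` chart_dom c) `&` (chart_inv c @^-1` U).
  apply/seteqP; split=> [_ [x [cx Ux] <-]|_ [[x cx <-]]] /=.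
    by split; [exists x | rewrite /= chart_mapK].
  by rewrite chart_mapK // => Ux; exists x.
rewrite openE => u [cu Uu]; apply: filterI.
  by apply: open_nbhs_nbhs; split=> //; exact: chart_img_open.
by apply: (chart_inv_cont cu); exact: open_nbhs_nbhs.
Qed.

Lemma smooth_sub U V f : V `<=` U -> smooth_on U f -> smooth_on V f.
Proof.
move=> VU sf c /sf + k => /(_ k); apply: Ck_sub.
by apply: image_subset; exact: setIS.
Qed.

Lemma smooth_local U f :
  (forall x, U x -> exists2 V, V x & smooth_on V f) -> smooth_on U f.
Proof.
move=> UV c ac k; apply: Ck_local => _ [x [cx /UV[V Vx sV]] <-].
by exists (c @` (chart_dom c `&` V)); [exists x | exact: sV].
Qed.

Lemma smooth_eq U f g : open U -> (forall x, U x -> f x = g x) ->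
  smooth_on U f -> smooth_on U g.
Proof.
move=> oU fg sf c ac k; apply: Ck_eq (sf c ac k); first exact: chart_setI_open.
by move=> _ [x [cx Ux] <-] /=; rewrite chart_mapK // fg.
Qed.

Lemma smooth_cst U (a : R) : smooth_on U (fun=> a).
Proof. by move=> c _ k; exact: Ck_cst. Qed.

Lemma smoothD U f g : open U -> smooth_on U f -> smooth_on U g ->
  smooth_on U (fun x => f x + g x).
Proof.
by move=> oU sf sg c ac k; apply: CkD (sf c ac k) (sg c ac k);
  exact: chart_setI_open.
Qed.

Lemma smoothM U f g : open U -> smooth_on U f -> smooth_on U g ->
  smooth_on U (fun x => f x * g x).
Proof.
by move=> oU sf sg c ac k; apply: CkM (sf c ac k) (sg c ac k);
  exact: chart_setI_open.
Qed.

Lemma smoothN U f : open U -> smooth_on U f -> smooth_on U (fun x => - f x).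
Proof.
move=> oU sf; apply: smooth_eq (smoothM oU (smooth_cst U (-1)) sf) => // x _.
by rewrite mulN1r.
Qed.

Lemma smooth_sum U (I : Type) (r : seq I) (F : I -> M -> R) : open U ->
  (forall i, smooth_on U (F i)) -> smooth_on U (fun x => \sum_(i <- r) F i x).
Proof.
move=> oU sF; elim: r => [|i r IH].
  by apply: smooth_eq (smooth_cst U 0) => // x _; rewrite big_nil.
by apply: smooth_eq (smoothD oU (sF i) IH) => // x _; rewrite big_cons.
Qed.

Record Cfun := MkCfun { Cfun_val :> M -> R; Cfun_smooth : smooth_on setT Cfun_val }.

HB.instance Definition _ := gen_eqMixin Cfun.
HB.instance Definition _ := gen_choiceMixin Cfun.

Lemma Cfun_eq (f g : Cfun) : (forall x, f x = g x) -> f = g.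
Proof.
case: f g => [f sf] [g sg] /= /funext fg; case: _ / fg in sg *.
by congr MkCfun; exact: Prop_irrelevance.
Qed.

Definition Ccst (a : R) := MkCfun (smooth_cst setT a).
Definition Cadd (f g : Cfun) :=
  MkCfun (smoothD openT (Cfun_smooth f) (Cfun_smooth g)).
Definition Cmul (f g : Cfun) :=
  MkCfun (smoothM openT (Cfun_smooth f) (Cfun_smooth g)).
Definition Copp (f : Cfun) := MkCfun (smoothN openT (Cfun_smooth f)).

Fact CaddA : associative Cadd.
Proof. by move=> *; apply: Cfun_eq => x; exact: addrA. Qed.
Fact CaddC : commutative Cadd.
Proof. by move=> *; apply: Cfun_eq => x; exact: addrC. Qed.
Fact Cadd0 : left_id (Ccst 0) Cadd.
Proof. by move=> *; apply: Cfun_eq => x; exact: add0r. Qed.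
Fact CaddN : left_inverse (Ccst 0) Copp Cadd.
Proof. by move=> *; apply: Cfun_eq => x; exact: addNr. Qed.
HB.instance Definition _ := GRing.isZmodule.Build Cfun CaddA CaddC Cadd0 CaddN.

Fact CmulA : associative Cmul.
Proof. by move=> *; apply: Cfun_eq => x; exact: mulrA. Qed.
Fact CmulC : commutative Cmul.
Proof. by move=> *; apply: Cfun_eq => x; exact: mulrC. Qed.
Fact Cmul1 : left_id (Ccst 1) Cmul.
Proof. by move=> *; apply: Cfun_eq => x; exact: mul1r. Qed.
Fact CmulD : left_distributive Cmul +%R.
Proof. by move=> *; apply: Cfun_eq => x; exact: mulrDl. Qed.
HB.instance Definition _ :=
  GRing.Zmodule_isComPzRing.Build Cfun CmulA CmulC Cmul1 CmulD.

End Functions.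

Section Tangent.
Context {R : realType} {n : nat} (M : manifold R n).

(* The tangent space at [x]: derivations at [x] of the algebra of smooth
   functions. *)
Record tangent (x : M) := MkTangent {
  tangent_val :> Cfun M -> R;
  tangent_linear : forall (a : R) f g,
    tangent_val (Ccst M a * f + g) = a * tangent_val f + tangent_val g;
  tangent_leibniz : forall f g,
    tangent_val (f * g) = tangent_val f * g x + f x * tangent_val g }.

HB.instance Definition _ x := gen_eqMixin (tangent x).
HB.instance Definition _ x := gen_choiceMixin (tangent x).

Section Lmodule.
Variable x : M.
Implicit Types v w : tangent x.

Lemma tangent_eq v w : (forall f, v f = w f) -> v = w.
Proof.
case: v w => [v lv dv] [w lw dw] /= /funext vw; case: _ / vw in lw dw *.
by congr MkTangent; exact: Prop_irrelevance.
Qed.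

Definition tangent0 : tangent x.
Proof.
by exists (fun=> 0) => *; rewrite ?mulr0 ?mul0r addr0.
Defined.

Definition tangent_add v w : tangent x.
Proof.
exists (fun f => v f + w f) => [a f g|f g].
  by rewrite !tangent_linear mulrDr addrACA.
by rewrite !tangent_leibniz mulrDl mulrDr addrACA.
Defined.

Definition tangent_scale (b : R) v : tangent x.
Proof.
exists (fun f => b * v f) => [a f g|f g].
  by rewrite tangent_linear mulrDr mulrCA.
by rewrite tangent_leibniz mulrDr mulrA mulrCA.
Defined.

Fact tangent_addA : associative tangent_add.
Proof. by move=> *; apply: tangent_eq => f; exact: addrA. Qed.
Fact tangent_addC : commutative tangent_add.
Proof. by move=> *; apply: tangent_eq => f; exact: addrC. Qed.
Fact tangent_add0 : left_id tangent0 tangent_add.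
Proof. by move=> *; apply: tangent_eq => f; exact: add0r. Qed.
Fact tangent_addN : left_inverse tangent0 (tangent_scale (-1)) tangent_add.
Proof. by move=> *; apply: tangent_eq => f; rewrite /= mulN1r addNr. Qed.
HB.instance Definition _ := GRing.isZmodule.Build (tangent x)
  tangent_addA tangent_addC tangent_add0 tangent_addN.

Fact tangent_scaleA a b v :
  tangent_scale a (tangent_scale b v) = tangent_scale (a * b) v.
Proof. by apply: tangent_eq => f; exact: mulrA. Qed.
Fact tangent_scale1 : left_id 1 tangent_scale.
Proof. by move=> v; apply: tangent_eq => f; exact: mul1r. Qed.
Fact tangent_scaleDr : right_distributive tangent_scale +%R.
Proof. by move=> *; apply: tangent_eq => f; exact: mulrDr. Qed.
Fact tangent_scaleDl v : {morph tangent_scale^~ v : a b / a + b}.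
Proof. by move=> *; apply: tangent_eq => f; exact: mulrDl. Qed.
HB.instance Definition _ := GRing.Zmodule_isLmodule.Build R (tangent x)
  tangent_scaleA tangent_scale1 tangent_scaleDr tangent_scaleDl.

End Lmodule.

(* A field of tangent vectors is smooth when it maps smooth functions to
   smooth functions. *)
Record vfield := MkVfield {
  vfield_val :> forall x : M, tangent x;
  vfield_smooth : forall f : Cfun M, smooth_on setT (fun x => vfield_val x f) }.

(* [X[f]] *)
Definition vfield_act (X : vfield) (f : Cfun M) : Cfun M :=
  MkCfun (vfield_smooth X f).

Lemma vfield_act_linear X (a : R) f g :
  vfield_act X (Ccst M a * f + g) = Ccst M a * vfield_act X f + vfield_act X g.
Proof. by apply: Cfun_eq => x; exact: tangent_linear. Qed.

Lemma vfield_act_leibniz X f g :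
  vfield_act X (f * g) = vfield_act X f * g + f * vfield_act X g.
Proof. by apply: Cfun_eq => x; exact: tangent_leibniz. Qed.

Lemma tangentD x (v : tangent x) f g : v (f + g) = v f + v g.
Proof.
have := tangent_linear v 1 f g; rewrite mul1r => <-; congr (v (_ + g)).
by apply: Cfun_eq => y; rewrite /= mul1r.
Qed.

Lemma tangent_fun0 x (v : tangent x) : v 0 = 0.
Proof. by apply: (addrI (v 0)); rewrite -tangentD !addr0. Qed.

(* [X, Y]_x f = X_x (Y[f]) - Y_x (X[f]) *)
Definition lie_bracket_at (X Y : vfield) (x : M) : tangent x.
Proof.
exists (fun f => X x (vfield_act Y f) - Y x (vfield_act X f)) => [a f g|f g].
  by rewrite !vfield_act_linear !tangent_linear mulrBr opprD addrACA.
rewrite !vfield_act_leibniz !tangentD !tangent_leibniz /=.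
by ring.
Defined.

Lemma lie_bracket_smooth (X Y : vfield) (f : Cfun M) :
  smooth_on setT (fun x => lie_bracket_at X Y x f).
Proof.
apply: (smoothD openT (vfield_smooth X (vfield_act Y f))).
exact: smoothN openT (vfield_smooth Y (vfield_act X f)).
Qed.

Definition lie_bracket (X Y : vfield) : vfield :=
  MkVfield (lie_bracket_smooth X Y).

End Tangent.

Section VectorBundle.
Context {R : realType} {n : nat} (M : manifold R n).

(* A smooth vector bundle of rank [r], given by its fibres and a family of
   local trivializations with smooth transition matrices.  The total space is
   [{x : M & fiber x}], with the smooth structure for which the
   trivializations are diffeomorphisms. *)
Record vbundle (r : nat) := VBundle {
  fiber :> M -> lmodType R;
  triv : Type;
  triv_dom : triv -> set M;
  triv_map : triv -> forall x, {linear fiber x -> 'rV[R]_r};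
  triv_inv : triv -> forall x, 'rV[R]_r -> fiber x;
  triv_open : forall i, open (triv_dom i);
  triv_cover : forall x, exists i, triv_dom i x;
  triv_mapK : forall i x, triv_dom i x ->
    cancel (triv_map i x) (triv_inv i x);
  triv_invK : forall i x, triv_dom i x ->
    cancel (triv_inv i x) (triv_map i x);
  triv_compat : forall i j (a b : 'I_r),
    smooth_on (triv_dom i `&` triv_dom j)
      (fun x => triv_map j x (triv_inv i x (delta_mx 0 a)) 0 b) }.

(* The local frame of the trivialization [i]. *)
Definition frame r (A : vbundle r) (i : triv A) (a : 'I_r) (x : M) : A x :=
  triv_inv i x (delta_mx 0 a).

Lemma frame_decomp r (A : vbundle r) (i : triv A) x (v : A x) :
  triv_dom i x -> v = \sum_a triv_map i x v 0 a *: frame i a x.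
Proof.
move=> ix; apply: (can_inj (triv_mapK ix)); rewrite linear_sum /=.
rewrite [LHS]row_sum_delta; apply: eq_bigr => a _.
by rewrite linearZ /= triv_invK.
Qed.

Section Sections.
Context {r : nat} (A : vbundle r).

Record Gamma := MkGamma {
  Gamma_val :> forall x, A x;
  Gamma_smooth : forall (i : triv A) (a : 'I_r),
    smooth_on (triv_dom i) (fun x => triv_map i x (Gamma_val x) 0 a) }.

HB.instance Definition _ := gen_eqMixin Gamma.
HB.instance Definition _ := gen_choiceMixin Gamma.

Lemma Gamma_eq (phi psi : Gamma) : (forall x, phi x = psi x) -> phi = psi.
Proof.
case: phi psi => [f sf] [g sg] /= fg.
have {}fg : f = g by apply: functional_extensionality_dep.
by case: _ / fg in sg *; congr MkGamma; exact: Prop_irrelevance.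
Qed.

Definition Gamma0 : Gamma.
Proof.
exists (fun x => 0) => i a.
by apply: smooth_eq (smooth_cst _ 0) => [|x _];
  [exact: triv_open | rewrite linear0 mxE].
Defined.

Definition Gamma_add (phi psi : Gamma) : Gamma.
Proof.
exists (fun x => phi x + psi x) => i a.
apply: smooth_eq (smoothD _ (Gamma_smooth phi i a) (Gamma_smooth psi i a));
  try exact: triv_open.
by move=> x _; rewrite linearD mxE.
Defined.

Definition Gamma_scale (f : Cfun M) (phi : Gamma) : Gamma.
Proof.
exists (fun x => f x *: phi x) => i a.
have sf : smooth_on (triv_dom i) f by apply: smooth_sub (Cfun_smooth f).
apply: smooth_eq (smoothM _ sf (Gamma_smooth phi i a)); try exact: triv_open.
by move=> x _; rewrite linearZ mxE.
Defined.

Fact Gamma_addA : associative Gamma_add.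
Proof. by move=> *; apply: Gamma_eq => x; exact: addrA. Qed.
Fact Gamma_addC : commutative Gamma_add.
Proof. by move=> *; apply: Gamma_eq => x; exact: addrC. Qed.
Fact Gamma_add0 : left_id Gamma0 Gamma_add.
Proof. by move=> *; apply: Gamma_eq => x; exact: add0r. Qed.
Fact Gamma_addN : left_inverse Gamma0 (Gamma_scale (-1)) Gamma_add.
Proof. by move=> *; apply: Gamma_eq => x; rewrite /= scaleN1r addNr. Qed.
HB.instance Definition _ :=
  GRing.isZmodule.Build Gamma Gamma_addA Gamma_addC Gamma_add0 Gamma_addN.

Fact Gamma_scaleA f g phi :
  Gamma_scale f (Gamma_scale g phi) = Gamma_scale (f * g) phi.
Proof. by apply: Gamma_eq => x; exact: scalerA. Qed.
Fact Gamma_scale1 : left_id 1 Gamma_scale.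
Proof. by move=> phi; apply: Gamma_eq => x; exact: scale1r. Qed.
Fact Gamma_scaleDr : right_distributive Gamma_scale +%R.
Proof. by move=> *; apply: Gamma_eq => x; exact: scalerDr. Qed.
Fact Gamma_scaleDl phi : {morph Gamma_scale^~ phi : f g / f + g}.
Proof. by move=> *; apply: Gamma_eq => x; exact: scalerDl. Qed.
HB.instance Definition _ := GRing.Zmodule_isLmodule.Build (Cfun M) Gamma
  Gamma_scaleA Gamma_scale1 Gamma_scaleDr Gamma_scaleDl.

(* A morphism of vector bundles to the tangent bundle, over the identity of
   [M].  It is smooth when it maps the local frames to smooth (local) vector
   fields. *)
Record bundle_map_to_TM := MkBundleMap {
  bundle_map :> forall x, {linear A x -> tangent x};
  bundle_map_smooth : forall (i : triv A) (a : 'I_r) (f : Cfun M),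
    smooth_on (triv_dom i) (fun x => bundle_map x (frame i a x) f) }.

Lemma tangent_sumE x (I : Type) (s : seq I) (F : I -> tangent x) (f : Cfun M) :
  (\sum_(i <- s) F i) f = \sum_(i <- s) F i f.
Proof. by elim: s => [|i s IH]; rewrite ?big_nil // !big_cons -IH. Qed.

Lemma bundle_map_apply_smooth (rho : bundle_map_to_TM) (phi : Gamma)
    (f : Cfun M) : smooth_on setT (fun x => rho x (phi x) f).
Proof.
apply: smooth_local => x _; have [i ix] := triv_cover A x.
exists (triv_dom i) => //; have oi := triv_open i.
apply: smooth_eq (smooth_sum (index_enum 'I_r) oi (fun a =>
  smoothM oi (Gamma_smooth phi i a) (bundle_map_smooth rho i a f))) => // y iy.
rewrite [in RHS](frame_decomp (phi y) iy) linear_sum tangent_sumE.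
by apply: eq_bigr => a _; rewrite linearZ.
Qed.

(* [rho(phi)] *)
Definition push (rho : bundle_map_to_TM) (phi : Gamma) : vfield M :=
  MkVfield (bundle_map_apply_smooth rho phi).

End Sections.
End VectorBundle.

(* [R]-bilinearity is stated with constant functions as scalars. *)
Record almost_lie_algebroid (R : realType) (n : nat) (M : manifold R n)
    (r : nat) := AlmostLieAlgebroid {
  bundle :> vbundle M r;
  anchor : bundle_map_to_TM bundle;
  bracket : Gamma bundle -> Gamma bundle -> Gamma bundle;
  bracket_linearl : forall (a : R) phi psi chi,
    bracket (Ccst M a *: phi + psi) chi =
    Ccst M a *: bracket phi chi + bracket psi chi;
  bracket_linearr : forall (a : R) phi psi chi,
    bracket chi (Ccst M a *: phi + psi) =
    Ccst M a *: bracket chi phi + bracket chi psi;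
  bracket_skew : forall phi psi, bracket phi psi = - bracket psi phi;
  bracket_leibniz : forall phi (f : Cfun M) psi,
    bracket phi (f *: psi) =
    vfield_act (push anchor phi) f *: psi + f *: bracket phi psi;
  anchor_bracket : forall phi psi,
    push anchor (bracket phi psi) =
    lie_bracket (push anchor phi) (push anchor psi) }.

Section AlmostLieAlgebroid.
Context {R : realType} {n : nat} {M : manifold R n} {r : nat}
        (A : almost_lie_algebroid M r).
Notation Gam := (Gamma A).
Notation "[[ phi , psi ]]" := (bracket phi psi).
Implicit Types (phi chi v : Gam).

Definition Gamma_ker v : Prop := forall x, anchor A x (v x) = 0.

(* Only meant for [v] in the kernel of the anchor. *)
Definition nabla phi v : Gam := [[phi, v]].

Lemma nabla_ker phi v : Gamma_ker v -> Gamma_ker (nabla phi v).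
Proof.
move=> v0 x; apply: tangent_eq => f.
have -> : anchor A x (nabla phi v x) =
    push (anchor A) [[phi, v]] x by [].
rewrite anchor_bracket /= (v0 x).
have -> : vfield_act (push (anchor A) v) f = Ccst M 0 * f + 0.
  by apply: Cfun_eq => y; rewrite /= (v0 y) mul0r addr0.
by rewrite tangent_linear mul0r add0r subr0 tangent_fun0.
Qed.

Definition cochain p := ('I_p -> Gam) -> Gam.

Definition replace p (psi : 'I_p -> Gam) (i : 'I_p) phi : 'I_p -> Gam :=
  fun k => if k == i then phi else psi k.

Definition multilinear p (omega : cochain p) :=
  forall (psi : 'I_p -> Gam) (i : 'I_p) (f : Cfun M) (phi chi : Gam),
  omega (replace psi i (f *: phi + chi)) =
  f *: omega (replace psi i phi) + omega (replace psi i chi).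

Definition alternating p (omega : cochain p) :=
  forall (psi : 'I_p -> Gam) (i j : 'I_p), i != j -> psi i = psi j -> omega psi = 0.

Definition Omega_ker p (omega : cochain p) :=
  [/\ multilinear omega, alternating omega &
      forall psi, Gamma_ker (omega psi)].

(* [psi_0, .., psi_p] without [psi_i] and [psi_j], in order *)
Definition omit2 p (psi : 'I_p.+1 -> Gam) (i j : 'I_p.+1) : seq Gam :=
  [seq psi k | k <- enum 'I_p.+1 & (k != i) && (k != j)].

(* [lift i] enumerates in increasing order the indices other than [i].  In
   the second sum the arguments of [alpha] are read off a list of length [p]. *)
Definition ext_cov_deriv p (alpha : cochain p) : cochain p.+1 := fun psi =>
  \sum_(i < p.+1)
     (-1) ^+ i *: nabla (psi i) (alpha (fun k => psi (lift i k))) +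
  \sum_(i < p.+1) \sum_(j < p.+1 | (i < j)%N)
     (-1) ^+ (i + j) *:
       alpha (fun k => nth 0 ([[psi i, psi j]] :: omit2 psi i j) k).

Definition jacobiator (phi psi chi : Gam) : Gam :=
  [[phi, [[psi, chi]]]] + [[psi, [[chi, phi]]]] + [[chi, [[phi, psi]]]].

Definition jacobiator_form : cochain 3 := fun psi =>
  jacobiator (psi (@Ordinal 3 0 isT)) (psi (@Ordinal 3 1 isT))
             (psi (@Ordinal 3 2 isT)).

Definition H_twisted : Prop :=
  forall psi, ext_cov_deriv jacobiator_form psi = 0.

End AlmostLieAlgebroid.

Arguments jacobiator_form {R n M r} A.
Arguments H_twisted {R n M r} A.

(* Main.v *)
(* Compatibility of the anchor with brackets cancels the derivatives of [f] in
   [J(phi, psi, f chi)] and gives [rho o J = 0] from the Jacobi identity of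
   vector fields.  The identity [DJ = 0] is formal: it holds for every
   bilinear skew-symmetric bracket. *)
Require Import Defs.
From mathcomp Require Import all_boot all_order all_algebra.
From mathcomp Require Import ring lra.
From mathcomp Require Import boolp classical_sets reals topology normedtype.

Set Implicit Arguments.
Unset Strict Implicit.
Unset Printing Implicit Defensive.
Import GRing.Theory.

Local Open Scope ring_scope.

Section Coordinates.
Context {R : realType} {n : nat} {M : manifold R n} {r : nat}.
Context {A : vbundle M r}.
Implicit Types phi psi : Gamma A.

(** Identities between sections are checked on fibre coordinates, where they become identities in
    [R] within reach of [ring] and [lra]. *)
Definition coord (i : triv A) (x : M) (a : 'I_r) phi : R :=
  triv_map i x (phi x) 0 a.

Lemma Gamma_coordP phi psi :
  (forall i x a, coord i x a phi = coord i x a psi) -> phi = psi.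
Proof.
move=> eq_coord; apply: Gamma_eq => x; have [i ix] := triv_cover A x.
by apply: (can_inj (triv_mapK ix)); apply/rowP => a; exact: eq_coord.
Qed.

Lemma coordD i x a phi psi :
  coord i x a (phi + psi) = coord i x a phi + coord i x a psi.
Proof. by rewrite /coord /= linearD mxE. Qed.

Lemma coordZ i x a (f : Cfun M) phi :
  coord i x a (f *: phi) = f x * coord i x a phi.
Proof. by rewrite /coord /= linearZ mxE. Qed.

Lemma coord0 i x a : coord i x a 0 = 0.
Proof. by rewrite -(scale0r 0) coordZ mul0r. Qed.

Lemma coordN i x a phi : coord i x a (- phi) = - coord i x a phi.
Proof. by apply/eqP; rewrite -addr_eq0 -coordD addNr coord0. Qed.

Definition coordE := (coordD, coordN, coordZ, coord0).

End Coordinates.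

Section Bracket.
Context {R : realType} {n : nat} {M : manifold R n} {r : nat}.
Context {A : almost_lie_algebroid M r}.
Notation "[[ phi , psi ]]" := (bracket phi psi).
Implicit Types (phi psi chi : Gamma A) (f g : Cfun M).

Definition anchor_act phi f : Cfun M := vfield_act (push (anchor A) phi) f.

Lemma anchor_actDl phi psi f :
  anchor_act (phi + psi) f = anchor_act phi f + anchor_act psi f.
Proof. by apply: Cfun_eq => x; rewrite /= linearD. Qed.

Lemma anchor_actDr phi f g :
  anchor_act phi (f + g) = anchor_act phi f + anchor_act phi g.
Proof. by apply: Cfun_eq => x; exact: tangentD. Qed.

Lemma anchor_actNr phi f : anchor_act phi (- f) = - anchor_act phi f.
Proof.
apply/eqP; rewrite -addr_eq0 -anchor_actDr addNr.
by apply/eqP/Cfun_eq => x; exact: tangent_fun0.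
Qed.

Lemma anchor_act_bracket phi psi f :
  anchor_act [[phi, psi]] f =
  anchor_act phi (anchor_act psi f) - anchor_act psi (anchor_act phi f).
Proof.
by rewrite /anchor_act anchor_bracket; apply: Cfun_eq.
Qed.

Lemma bracketDr phi psi chi : [[chi, phi + psi]] = [[chi, phi]] + [[chi, psi]].
Proof. by have := bracket_linearr 1 phi psi chi; rewrite !scale1r. Qed.

Lemma bracketNr phi psi : [[psi, - phi]] = - [[psi, phi]].
Proof.
have bracket0 : [[psi, 0]] = 0.
  by apply: (addrI [[psi, 0]]); rewrite -bracketDr !addr0.
by apply/eqP; rewrite -addr_eq0 -bracketDr addNr bracket0.
Qed.

(** Here [chi] sits in the right slot of every bracket, ready for the Leibniz rule. *)
Lemma jacobiatorE phi psi chi :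
  jacobiator phi psi chi =
  [[phi, [[psi, chi]]]] - [[psi, [[phi, chi]]]] - [[[[phi, psi]], chi]].
Proof.
rewrite /jacobiator (bracket_skew chi phi) bracketNr.
by rewrite (bracket_skew chi [[phi, psi]]).
Qed.

Lemma jacobiator_cycle phi psi chi :
  jacobiator phi psi chi = jacobiator psi chi phi.
Proof. by rewrite /jacobiator -addrA addrC. Qed.

Lemma jacobiator_swap phi psi chi :
  jacobiator psi phi chi = - jacobiator phi psi chi.
Proof.
rewrite !jacobiatorE (bracket_skew psi phi).
rewrite (bracket_skew (- _) chi) bracketNr -(bracket_skew _ chi).
by apply: Gamma_coordP => i x a; rewrite !coordE; ring.
Qed.

(** Swapping the equal arguments gives $J = -J$, and 2 is invertible in [R]. *)
Lemma jacobiator_diag phi chi : jacobiator phi phi chi = 0.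
Proof.
apply: Gamma_coordP => i x a.
have := congr1 (coord i x a) (jacobiator_swap phi phi chi).
by rewrite !coordE; lra.
Qed.

Lemma jacobiator_linear phi psi f chi1 chi2 :
  jacobiator phi psi (f *: chi1 + chi2) =
  f *: jacobiator phi psi chi1 + jacobiator phi psi chi2.
Proof.
rewrite !jacobiatorE !(bracketDr, bracket_leibniz) -!/(anchor_act _ _).
(* The terms with one derivative of [f] cancel by symmetry in [phi] and [psi]; the second
   derivatives cancel against $\rho([\phi,\psi])[f]$, expanded here. *)
rewrite anchor_act_bracket.
by apply: Gamma_coordP => i x a; rewrite !coordE /=; ring.
Qed.

Lemma jacobiator_ker phi psi chi : Gamma_ker (jacobiator phi psi chi).
Proof.
move=> x; apply: tangent_eq => f.
have -> : anchor A x (jacobiator phi psi chi x) f =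
  anchor_act (jacobiator phi psi chi) f x by [].
suff -> : anchor_act (jacobiator phi psi chi) f = 0 by [].
rewrite /jacobiator !anchor_actDl.
(* This leaves twelve signed triple derivatives of [f], which cancel in pairs. *)
rewrite !(anchor_act_bracket, anchor_actDr, anchor_actNr).
by apply: Cfun_eq => y; rewrite /=; ring.
Qed.

(** Cyclic invariance moves the varied slot to the third place. *)
Lemma jacobiator_form_multilinear : multilinear (jacobiator_form A).
Proof.
move=> psi [ [|[|[|//] ] ] lti] f phi chi; rewrite /jacobiator_form /replace /=.
- by rewrite !(jacobiator_cycle _ (psi _) (psi _)) jacobiator_linear.
- by rewrite -!(jacobiator_cycle (psi _) (psi _)) jacobiator_linear.
- exact: jacobiator_linear.
Qed.

Lemma jacobiator_form_alternating : alternating (jacobiator_form A).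
Proof.
move=> psi [ [|[|[|//] ] ] lti] [ [|[|[|//] ] ] ltj] // _;
  (* The bound proofs become those in [jacobiator_form], so that [eq_ij] matches its arguments;
     rotation then makes the equal arguments the first two. *)
  rewrite (bool_irrelevance lti isT) (bool_irrelevance ltj isT);
  rewrite /jacobiator_form => eq_ij.
- by rewrite eq_ij jacobiator_diag.
- by rewrite -jacobiator_cycle eq_ij jacobiator_diag.
- by rewrite eq_ij jacobiator_diag.
- by rewrite jacobiator_cycle eq_ij jacobiator_diag.
- by rewrite -jacobiator_cycle eq_ij jacobiator_diag.
- by rewrite jacobiator_cycle eq_ij jacobiator_diag.
Qed.

(* After moving the double brackets to the right of single ones, the terms
   [[x, [[y, [[z, w]]]]]] cancel between the two sides, and the terms
   [[[[x, y]], [[z, w]]]] cancel in pairs by skew-symmetry. *)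
Lemma jacobiator_closed (a b c d : Gamma A) :
  [[a, jacobiator b c d]] - [[b, jacobiator a c d]]
  + [[c, jacobiator a b d]] - [[d, jacobiator a b c]]
  = jacobiator [[a, b]] c d - jacobiator [[a, c]] b d + jacobiator [[a, d]] b c
    + jacobiator [[b, c]] a d - jacobiator [[b, d]] a c
    + jacobiator [[c, d]] a b.
Proof.
have jacobiator_ordered (x y z : Gamma A) : jacobiator x y z =
    [[x, [[y, z]]]] - [[y, [[x, z]]]] + [[z, [[x, y]]]].
  by rewrite jacobiatorE (bracket_skew [[x, y]]) opprK.
have jacobiator_bracket (x y z w : Gamma A) : jacobiator [[x, y]] z w =
    [[ [[x, y]], [[z, w]] ]] + [[z, [[w, [[x, y]]]]]] - [[w, [[z, [[x, y]]]]]].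
  by rewrite /jacobiator (bracket_skew [[x, y]] z) bracketNr.
rewrite !jacobiator_bracket !jacobiator_ordered !(bracketDr, bracketNr).
rewrite (bracket_skew [[b, c]] [[a, d]]) (bracket_skew [[b, d]] [[a, c]]).
rewrite (bracket_skew [[c, d]] [[a, b]]).
by apply: Gamma_coordP => i x e; rewrite !coordE; ring.
Qed.

(** Unlike [enum 'I_p.+1], the list [iota 0 p.+1] of naturals computes for concrete [p], [i] and
    [j]. *)
Lemma omit2E p (psi : 'I_p.+1 -> Gamma A) (i j : 'I_p.+1) (s : seq (Gamma A)) :
  psi = (fun k => nth 0 s k) ->
  omit2 psi i j =
  [seq nth 0 s k | k <- iota 0 p.+1 & (k != i :> nat) && (k != j :> nat)].
Proof. by move=> ->; rewrite /omit2 -val_enum_ord filter_map -map_comp. Qed.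

Lemma jacobiator_form_closed : H_twisted A.
Proof.
(* Reading [psi] off a list makes its values depend on the natural number under an ordinal only, so
   that [lift] and [omit2] yield the same terms. *)
move=> psi; pose s := [seq psi k | k <- enum 'I_4].
have psiE : psi = (fun k => nth 0 s k).
  apply/funext => k.
  by rewrite (nth_map k) ?size_enum_ord ?nth_ord_enum.
rewrite /ext_cov_deriv.
under [X in _ + X]eq_bigr do under eq_bigr do rewrite (omit2E _ _ psiE).
rewrite {}psiE; clearbody s => {psi}.
(* With $i<j$ as a conditional, the inner sums range over all of ['I_4] and can be unrolled. *)
under [X in _ + X]eq_bigr do rewrite big_mkcond.
rewrite !big_ord_recl !big_ord0 /=.
rewrite /jacobiator_form /nabla /bump /= !(add0n, add1n, addSn, addn0) /=.
rewrite !(exprS, expr0, mulrN1, mulN1r, opprK, scaleN1r, scale1r).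
apply: Gamma_coordP => i x a.
(* With the signs $(-1)^{i+j}$, the goal is the left side minus the right side of this identity. *)
have := congr1 (coord i x a) (jacobiator_closed s`_0 s`_1 s`_2 s`_3).
by rewrite !coordE; lra.
Qed.

End Bracket.

Theorem theorem3p1 (R : realType) (n : nat) (M : manifold R n) (r : nat)
    (A : almost_lie_algebroid M r) :
  (forall phi psi chi : Gamma A, Gamma_ker (jacobiator phi psi chi)) /\
  Omega_ker (jacobiator_form A) /\
  H_twisted A.
Proof.
split; first exact: jacobiator_ker.
split; last exact: jacobiator_form_closed.
split; first exact: jacobiator_form_multilinear.
- exact: jacobiator_form_alternating.
- by move=> psi; exact: jacobiator_ker.
Qed.
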